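(* Fix $q\in(0,1)$ and let $\Gamma_n=\bigsqcup_{j=1}^{r_n}K_{1,d_{j,n}}$ be a disjoint union of $r_n\ge1$ stars, where the degrees $d_{j,n}\ge1$ are arbitrary (with $|v(\Gamma_n)|\le n$). Let $S_{2,n}=\sum_{j=1}^{r_n}d_{j,n}^2$. If $$\frac{Q_nS_{2,n}}{n(n-r_n)^2}\to0,$$ then weak detection is impossible with query budget $Q_n$. In particular, if $r_n=o(n)$ and $Q_n=o\left(\frac{n^3}{S_{2,n}}\right)$, then weak detection is impossible with query budget $Q_n$.
   Context: Setup. Under $\mathcal H_0$, $G$ is a random graph on $[n]=\{1,\dots,n\}$ in which each pair in $\binom{[n]}{2}$ is an edge independently with probability $q$. Under $\mathcal H_1$, a copy $\Gamma_n^\star$ is drawn uniformly from the set of all subgraphs of the complete graph on $[n]$ isomorphic to $\Gamma_n$; all edges of $\Gamma_n^\star$ are in $G$, and every other pair is an edge independently with probability $q$. $K_{1,d}$ is the star with one center and $d$ leaves. For a query set $\mathcal Q\subseteq\binom{[n]}{2}$ (chosen non-adaptively), the transcript is $G_{\mathcal Q}=(\mathbf 1\{e\in e(G)\})_{e\in\mathcal Q}$, with laws $\mathbb P_{\mathcal H_0,\mathcal Q}$, $\mathbb P_{\mathcal H_1,\mathcal Q}$. The optimal risk under budget $Q_n$ is $R^\star_{n,Q_n}=1-\sup_{|\mathcal Q|\le Q_n} d_{\mathrm{TV}}(\mathbb P_{\mathcal H_1,\mathcal Q},\mathbb P_{\mathcal H_0,\mathcal Q})$. Weak detection is impossible with budget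 $Q_n$ if $\lim_nR^\star_{n,Q_n}=1$. *)

(* Defs.v *)
From HB Require Import structures.
From mathcomp Require Import all_boot all_order all_algebra.
From mathcomp Require Import all_classical all_reals all_analysis.

Set Implicit Arguments.
Unset Strict Implicit.
Unset Printing Implicit Defensive.

Import Order.TTheory GRing.Theory Num.Theory.
Import numFieldNormedType.Exports.

Local Open Scope ring_scope.
Local Open Scope set_scope.

Record sgraph := SGraph {
  vertex :> finType;
  adj : rel vertex;
  adj_sym : symmetric adj;
  adj_irr : irreflexive adj }.

(* In [option 'I_d], [None] is the center and the [Some i] are the leaves. *)
Definition star_adj (d : nat) : rel (option 'I_d) :=
  fun u v => isSome u (+) isSome v.

Lemma star_adj_sym d : symmetric (@star_adj d).
Proof. by move=> u v; rewrite /star_adj addbC. Qed.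

Lemma star_adj_irr d : irreflexive (@star_adj d).
Proof. by move=> u; rewrite /star_adj addbb. Qed.

Definition star (d : nat) : sgraph :=
  SGraph (@star_adj_sym d) (@star_adj_irr d).

Section DisjointUnion.
Variables (r : nat) (G : 'I_r -> sgraph).

(* [tagged_as u v] is the second component of [v] transported to the part of
   [u]; it is only meaningful when both lie in the same part. *)
Definition djunion_adj : rel {j : 'I_r & G j} :=
  fun u v => (tag u == tag v) && adj (tagged u) (tagged_as u v).

Lemma djunion_adj_sym : symmetric djunion_adj.
Proof.
move=> [i x] [j y]; rewrite /djunion_adj /= [j == i]eq_sym.
case: eqP => //= eq_ij; case: j / eq_ij y => y.
by rewrite !tagged_asE adj_sym.
Qed.

Lemma djunion_adj_irr : irreflexive djunion_adj.
Proof. by move=> [i x]; rewrite /djunion_adj tagged_asE adj_irr andbF. Qed.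

Definition djunion : sgraph := SGraph djunion_adj_sym djunion_adj_irr.
End DisjointUnion.

Definition star_forest (r : nat) (d : 'I_r -> nat) : sgraph :=
  djunion (fun j => star (d j)).

(* The set binom([n], 2); a graph on [n] is given by its edge set, of type
   [{set upair n}]. *)
Definition upair (n : nat) : finType := {e : {set 'I_n} | #|e| == 2}.

Section Copies.
Variables (n : nat) (Gamma : sgraph).

(* A subgraph of the complete graph on [n] is a pair (W, F) of a vertex set
   and a set of edges with both ends in W. *)
Definition is_copy (H : {set 'I_n} * {set upair n}) : bool :=
  [forall e in H.2, val e \subset H.1] &&
  [exists f : {ffun Gamma -> 'I_n},
    [&& injectiveb f, f @: [set: Gamma] == H.1 &
        [forall u, forall v, adj u v == ([set f u; f v] \in val @: H.2)]]].

Definition copies : {set {set 'I_n} * {set upair n}} := [set H | is_copy H].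
End Copies.

Section Detection.
Variables (R : realType) (q : R) (n : nat).

Definition null_law (E : {set upair n}) : R :=
  \prod_(e : upair n) (if e \in E then q else 1 - q).

Definition planted_law_at (F E : {set upair n}) : R :=
  \prod_(e : upair n)
    (if e \in F then (e \in E)%:R else if e \in E then q else 1 - q).

Definition planted_law (Gamma : sgraph) (E : {set upair n}) : R :=
  #|copies n Gamma|%:R^-1 * \sum_(H in copies n Gamma) planted_law_at H.2 E.

Definition transcript (Q E : {set upair n}) : {ffun {e | e \in Q} -> bool} :=
  [ffun e => val e \in E].

Definition transcript_law (Q : {set upair n}) (P : {set upair n} -> R)
    (t : {ffun {e | e \in Q} -> bool}) : R :=
  \sum_(E | transcript Q E == t) P E.

(* For probability mass functions, half the l^1 distance is the supremum over
   events of the difference of probabilities. *)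
Definition dTV (T : finType) (mu nu : T -> R) : R :=
  2^-1 * \sum_(t : T) `|mu t - nu t|.

Definition optimal_risk (Gamma : sgraph) (budget : nat) : R :=
  1 - sup [set dTV (transcript_law (Q := Q) (planted_law Gamma))
                   (transcript_law (Q := Q) null_law)
          | Q in [set Q : {set upair n} | (#|Q| <= budget)%N]]%classic.
End Detection.

Definition weak_detection_impossible (R : realType) (q : R)
    (Gamma : nat -> sgraph) (budget : nat -> nat) : Prop :=
  (optimal_risk q n (Gamma n) (budget n) @[n --> \oo] --> (1 : R))%classic.

Definition sum_sq_deg (r : nat) (d : 'I_r -> nat) : nat :=
  (\sum_(j < r) d j ^ 2)%N.

(* Main.v *)
(* Reveal the centers of the planted stars first. Given the center map c, expand
   the likelihood ratio of the planted transcript in the orthogonal functions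
   walsh T (T a set of queried pairs), with variance (1/q - 1)^|T|: its
   coefficient on walsh T is the probability p_T that the planted forest covers
   T. Such a T prescribes the images of |T| distinct leaves up to a choice of the
   leaf in its star, so with m = n - r, p_T is at most the product over T of
   the degrees divided by m(m-1)...(m-|T|+1) >= (m/exp 1)^|T|. Hence the
   chi-square divergence is at most exp(t_c) - 1, where t_c is a constant times
   the sum over queried pairs e of d_j^2/m^2 for the star j centered at an
   end of e. Each vertex is the center of star j with probability 1/n, so t_c has mean
   O(Q_n S_2 / (n m^2)), and convexity of the squared total variation distance
   removes the conditioning. Since every degree is at least 1, 2 r <= n; hence
   n (n - r)^2 is of order n^3, which gives the second part. *)
Require Import Defs.
From HB Require Import structures.
From mathcomp Require Import all_boot all_order all_algebra.
From mathcomp Require Import all_classical all_reals all_analysis.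
From mathcomp Require Import ring lra.

Set Implicit Arguments.
Unset Strict Implicit.
Unset Printing Implicit Defensive.

Import Order.TTheory GRing.Theory Num.Theory.
Import numFieldNormedType.Exports.

Local Open Scope ring_scope.

(** * Elementary inequalities and counting of injections *)

Lemma sqr_mean_le (R : realDomainType) (I : finType) (p x : I -> R) :
  (forall i, 0 <= p i) -> \sum_i p i = 1 ->
  (\sum_i p i * x i) ^+ 2 <= \sum_i p i * x i ^+ 2.
Proof.
move=> p_ge0 p_sum1; have [s sE] : {s | s = \sum_i p i * x i} by eexists.
(* The variance of [x] under [p] is nonnegative; expanding the square gives the claim. *)
rewrite -sE; have : 0 <= \sum_i p i * (x i - s) ^+ 2.
  by apply: sumr_ge0 => i _; rewrite mulr_ge0 ?sqr_ge0.
have -> : \sum_i p i * (x i - s) ^+ 2 =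
    \sum_i p i * x i ^+ 2 + (- (2 * s) * s + s ^+ 2 * \sum_i p i).
  rewrite [X in - (2 * s) * X]sE !mulr_sumr -!big_split /=.
  by apply: eq_bigr => i _; ring.
by rewrite p_sum1; set M := \sum_i _ => ?; lra.
Qed.

(** Induction on the number of points outside [A]. Classify [f] by its value at some [u] outside
    [A]: a value in the image of [A] allows no injection, and each of the [#|W| - #|A|] others
    reduces to the same count for [u |: A]. *)
Lemma card_inj_extend (V W : finType) (A : {set V}) (g : V -> W) :
  {in A &, injective g} ->
  #|[set f : {ffun V -> W} | injectiveb f & [forall u in A, f u == g u]]| =
  ((#|W| - #|A|) ^_ (#|V| - #|A|))%N.
Proof.
have [k] := ubnP (#|V| - #|A|)%N.
elim: k => // k IH in A g * => + g_inj.
have [AT _|] := eqVneq A [set: V].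
  rewrite AT cardsT subnn ffactn0.
  apply/eqP/cards1P; exists (finfun g); apply/setP => f; rewrite !inE.
  apply/andP/eqP => [[_ /forall_inP fg]|->].
    by apply/ffunP => u; rewrite ffunE; apply/eqP/fg; rewrite inE.
  split; last by apply/forall_inP => u _; rewrite ffunE.
  by apply/injectiveP => u v; rewrite !ffunE; apply: g_inj; rewrite AT inE.
rewrite -finset.subTset => /subsetPn[u _ uA] ltk.
have cA : #|u |: A| = #|A|.+1 by rewrite cardsU1 uA.
have ltAV : (#|A| < #|V|)%N by rewrite -cA max_card.
set S := [set f : {ffun V -> W} | injectiveb f & [forall v in A, f v == g v]].
pose g' x v := if v == u then x else g v.
rewrite -sum1_card (partition_big (fun f : {ffun V -> W} => f u) predT) //=.
have eqg' x : x \notin g @: A -> (\sum_(f in S | f u == x) 1 =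
    (#|W| - #|A|).-1 ^_ (#|V| - #|A|).-1)%N.
  move=> xA; rewrite sum1dep_card -!subnS -cA -(IH _ (g' x)).
  - apply: eq_card => f; rewrite !inE -andbA; congr (_ && _).
    apply/andP/forall_inP => [[/forall_inP fg fu] v|fg].
      rewrite /g' !inE; have [->//|_/=] := eqVneq v u; exact: fg.
    split; last by have := fg u (finset.setU11 _ _); rewrite /g' eqxx.
    apply/forall_inP => v vA; have := fg v (finset.setU1r _ vA).
    by rewrite /g' (negPf (memPn uA _ vA)).
  - by rewrite cA subnS; case: (#|V| - #|A|)%N (subn_gt0 #|A| #|V|) ltk => // ;
      rewrite ltAV.
  - move=> v w; rewrite /g' !inE.
    have [->|_] := eqVneq v u; have [->|_] //= := eqVneq w u.
    + by move=> _ wA xg; case/imsetP: xA; exists w.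
    + by move=> vA _ xg; case/imsetP: xA; exists v.
    + exact: g_inj.
rewrite (bigID [in g @: A]) /= big1 => [|x /imsetP[v vA ->]]; last first.
  apply: big1 => f; rewrite !inE => /andP[/andP[/injectiveP f_inj]].
  move=> /forall_inP/(_ _ vA)/eqP <- /eqP/f_inj uv.
  by rewrite uv vA in uA.
rewrite add0n (eq_bigr _ eqg') sum_nat_const.
rewrite -[X in (_ = _ ^_ X)%N](prednK _) ?subn_gt0 // ffactnS; congr (_ * _)%N.
rewrite -(card_in_imset g_inj) -cardsT -cardsDS ?finset.subsetT //.
by apply: eq_card => x; rewrite !inE andbT.
Qed.

(** Induction reduces it to (m+1)^k <= e m^k for k <= m, which holds because (1 + 1/m)^k <= exp(k/m)
    <= e. *)
Lemma exp_ffact_le (R : realType) (m k : nat) : (k <= m)%N ->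
  (m%:R ^+ k : R) <= expR 1 ^+ k * (m ^_ k)%:R.
Proof.
elim: k m => [|k IH] [|m] // lekm; rewrite ?expr0 ?ffactn0 ?mulr1 //.
rewrite ffactSS natrM exprS [in leRHS]exprS.
suff H : m.+1%:R ^+ k <= expR 1 * (m%:R ^+ k : R).
  rewrite mulrACA [expR 1 * _]mulrC -mulrA; apply: ler_wpM2l => //.
  apply: (le_trans H); apply: ler_wpM2l; rewrite ?expR_ge0 //; exact: IH.
(* For [m = 0] the exponent is 0 as well, and only 1 <= e remains. *)
case: m lekm => [|m] lekm.
  by case: k lekm {IH} => // _; rewrite !expr0 mulr1 -[leLHS]expR0 ler_expR.
have m_gt0 : 0 < m.+1%:R :> R by rewrite ltr0n.
have -> : m.+2%:R = (1 + m.+1%:R^-1) * m.+1%:R :> R.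
  by rewrite mulrDl mul1r mulVf ?gt_eqF // -[m.+2]addn1 natrD.
rewrite exprMn; apply: ler_wpM2r; first by rewrite exprn_ge0 ?ltW.
apply: (@le_trans _ _ (expR (k%:R / m.+1%:R))).
  by rewrite expRM_natl lerXn2r ?nnegrE ?expR_ge0 ?expR_ge1Dx ?addr_ge0 ?invr_ge0 ?ltW.
by rewrite ler_expR ler_pdivrMr // mul1r ler_nat.
Qed.

Lemma ffactD n k l : (n ^_ (k + l) = n ^_ k * (n - k) ^_ l)%N.
Proof.
elim: k n => [|k IH] n; first by rewrite subn0 mul1n.
by rewrite addSn !ffactnS IH mulnA -subn1 -subnDA add1n.
Qed.

Lemma card_le_sum_cover (A B : finType) (X : {set A}) (P : pred B) (Y : B -> {set A}) :
  (forall a, a \in X -> exists2 b, P b & a \in Y b) ->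
  (#|X| <= \sum_(b | P b) #|Y b|)%N.
Proof.
move=> XY; rewrite -sum1_card.
apply: (@leq_trans (\sum_(a in X) \sum_(b | P b) (a \in Y b))%N).
  by apply: leq_sum => a /XY[b Pb aY]; rewrite (bigD1 b) //= aY.
rewrite exchange_big /=; apply: leq_sum => b _.
rewrite -sum1_card big_mkcond [leqRHS]big_mkcond; apply: leq_sum => a _.
by case: (a \in X); case: (a \in Y b).
Qed.

Lemma sum_subset_prod (R : comPzRingType) (I : finType) (Q : {set I}) (x : I -> R) :
  \sum_(T : {set I} | T \subset Q) \prod_(i in T) x i = \prod_(i in Q) (x i + 1).
Proof.
(* Setting [x] to 0 outside [Q] makes the product total, so that distributivity applies; subsets not
   inside [Q] then contribute 0. *)
transitivity (\prod_i ((if i \in Q then x i else 0) + 1)); last first.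
  rewrite [RHS]big_mkcond; apply: eq_bigr => i _.
  by case: ifP; rewrite ?add0r.
rewrite bigA_distr [RHS](bigID (fun T : {set I} => T \subset Q)) /=.
rewrite [X in _ = _ + X]big1 ?addr0 => [|T /fintype.subsetPn[i iT iQ]]; last first.
  by rewrite (bigD1 i) //= iT (negPf iQ) mul0r.
apply: eq_bigr => T /fintype.subsetP TQ; rewrite big_mkcond.
by apply: eq_bigr => i _; case: ifP => // /TQ ->.
Qed.

Lemma prod_le_expR (R : realType) (I : finType) (Q : {set I}) (x : I -> R) :
  (forall i, 0 <= x i) -> \prod_(i in Q) (x i + 1) <= expR (\sum_(i in Q) x i).
Proof.
move=> x_ge0; rewrite expR_sum; apply: ler_prod => i _.
by rewrite addr_ge0 //= addrC expR_ge1Dx.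
Qed.

(** * Orthogonal expansion with respect to the null law *)

Section Fourier.
Variables (R : realType) (q : R) (n : nat).
Hypotheses (q_gt0 : 0 < q) (q_lt1 : q < 1).
Implicit Types (E F T Q : {set upair n}) (t : bool).

(** Each factor is a centered edge indicator divided by [q]: it has mean 0 and variance 1/q - 1
    under the null law, and 1 plus it is the likelihood ratio of planting that single pair. *)
Definition walsh T E : R := \prod_(e in T) ((e \in E)%:R / q - 1).

Lemma null_law_ge0 E : 0 <= null_law q E.
Proof. by apply: prodr_ge0 => e _; case: ifP => _; rewrite ?subr_ge0 ltW. Qed.

Lemma sum_null_law_prod (phi : upair n -> bool -> R) :
  \sum_(E : {set upair n}) null_law q E * \prod_e phi e (e \in E) =
  \prod_e (q * phi e true + (1 - q) * phi e false).
Proof.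
rewrite bigA_distr; apply: eq_big => // E _; rewrite -big_split /=.
by apply: eq_bigr => e _; case: ifP.
Qed.

Lemma sum_null_law : \sum_(E : {set upair n}) null_law q E = 1.
Proof.
have <- : \prod_(e : upair n) (q * 1 + (1 - q) * 1) = 1.
  by apply: big1 => e _; ring.
rewrite -(sum_null_law_prod (fun _ _ => 1)); apply: eq_bigr => E _.
by rewrite big1 ?mulr1.
Qed.

(** The likelihood ratio of planting [F] is a product over the pairs of [F] of 1 plus the [walsh]
    factor; expanding it gives the sum over subsets. *)
Lemma planted_law_atE F E :
  planted_law_at q F E = null_law q E * \sum_(T : {set upair n} | T \subset F)
    walsh T E.
Proof.
rewrite sum_subset_prod big_mkcond /= -big_split /=; apply: eq_bigr => e _.
have q0 : q != 0 by rewrite gt_eqF.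
by case: (e \in F); case: (e \in E) => /=; field.
Qed.

Lemma walsh_orthogonal T T' :
  \sum_(E : {set upair n}) null_law q E * (walsh T E * walsh T' E) =
  (T == T')%:R * (q^-1 - 1) ^+ #|T|.
Proof.
pose w (b c : bool) : R := if b then c%:R / q - 1 else 1.
have q0 : q != 0 by rewrite gt_eqF.
have wE S E : walsh S E = \prod_e w (e \in S) (e \in E).
  by rewrite /walsh big_mkcond.
under eq_bigr do rewrite !wE -big_split /=.
rewrite (sum_null_law_prod (fun e b => w (e \in T) b * w (e \in T') b)).
have [<-|] := eqVneq T T'.
  rewrite mul1r -prodr_const [RHS]big_mkcond /=; apply: eq_bigr => e _.
  rewrite /w; case: (e \in T) => /=; last by ring.
  by field.
rewrite mul0r => /eqP neqT.
(* At a pair in the symmetric difference a single centered factor stands alone, so the product of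
   means vanishes. *)
have [e neqe] : exists e, (e \in T) != (e \in T').
  apply/existsP; apply: contra_notT neqT; rewrite negb_exists => /forallP eqT.
  by apply/setP => e; apply/eqP; have := eqT e; rewrite negbK.
rewrite (bigD1 e) //= (_ : _ + _ = 0) ?mul0r // /w.
by case: (e \in T) neqe; case: (e \in T') => // _ /=; field.
Qed.

(** A pair of [T] outside [Q] stays independent of the transcript, and its centered factor averages
    to 0. *)
Lemma walsh_marginal Q T (t : {ffun {e | e \in Q} -> bool}) : ~~ (T \subset Q) ->
  \sum_(E | transcript Q E == t) null_law q E * walsh T E = 0.
Proof.
move=> /fintype.subsetPn[e eT eQ].
(* [E0] collects the pairs that [t] reports as present, so that the event of seeing [t] becomes a
   product of one constraint per queried pair. *)
pose E0 := [set val x | x in [pred x | t x]].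
have q0 : q != 0 by rewrite gt_eqF.
pose phi x (b : bool) : R := (if x \in T then b%:R / q - 1 else 1) *
   ((x \in Q) ==> (b == (x \in E0)))%:R.
have phi0 : \sum_(E : {set upair n}) null_law q E * \prod_x phi x (x \in E) = 0.
  rewrite (sum_null_law_prod phi) (bigD1 e) //= (_ : _ + _ = 0) ?mul0r // /phi.
  by rewrite eT (negPf eQ) /=; field.
rewrite -[RHS]phi0 [LHS]big_mkcond; apply: eq_bigr => E _ /=.
have -> : (transcript Q E == t) = [forall x in Q, (x \in E) == (x \in E0)].
  have tE0 (x : {e | e \in Q}) : t x = (val x \in E0).
    by rewrite mem_imset ?inE //; exact: val_inj.
  apply/eqP/forall_inP => [tE x xQ|H].
    by rewrite -[x]/(val (Sub x xQ : {e | e \in Q})) -tE0 -tE ffunE.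
  by apply/ffunP => x; rewrite ffunE tE0; apply/eqP/H/valP.
rewrite /phi big_split /= -big_mkcond -/(walsh T E).
case: ifPn => [/forall_inP H|/forall_inPn[x xQ neqx]].
  rewrite [X in _ = _ * (_ * X)]big1 ?mulr1 // => x _.
  by case: (boolP (x \in Q)) => //= /H ->.
by rewrite [X in _ = _ * (_ * X)](bigD1 x) //= xQ (negPf neqx) mul0r !mulr0.
Qed.

End Fourier.

(** * Chi-square bound for a mixture of planted sets *)

Section Mixture.
Variables (R : realType) (q : R) (n : nat).
Hypotheses (q_gt0 : 0 < q) (q_lt1 : q < 1).
Variables (I : finType) (p : I -> R) (F : I -> {set upair n}).
Hypotheses (p_sum1 : \sum_i p i = 1).
Implicit Types (E T Q : {set upair n}).

Definition mixture E : R := \sum_i p i * planted_law_at q (F i) E.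

Definition cover_prob T : R := \sum_(i | T \subset F i) p i.

Lemma mixtureE E :
  mixture E = null_law q E * \sum_(T : {set upair n}) cover_prob T * walsh q T E.
Proof.
rewrite /mixture mulr_sumr; under eq_bigr do rewrite planted_law_atE // mulrCA
  mulr_sumr big_mkcond mulr_sumr.
rewrite exchange_big /=; apply: eq_bigr => T _.
rewrite mulr_suml mulr_sumr [RHS]big_mkcond; apply: eq_bigr => i _ /=.
by case: ifP; rewrite ?mulr0.
Qed.

(** The total variation distance is half an L1 norm, which is at most the L2 norm; Parseval
    evaluates the latter. Only [T] inside [Q] survive marginalization, and subtracting 1 removes the
    empty [T]. *)
Lemma sqr_dTV_mixture_le Q :
  dTV (transcript_law (Q := Q) mixture) (transcript_law (Q := Q) (null_law q (n
    := n))) ^+ 2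
  <= 4^-1 * (\sum_(T : {set upair n} | T \subset Q) (q^-1 - 1) ^+ #|T| *
    cover_prob T ^+ 2 - 1).
Proof.
have cov0 : cover_prob finset.set0 = 1.
  by rewrite -p_sum1; apply: eq_bigl => i; rewrite finset.sub0set.
have walsh0 E : walsh q finset.set0 E = 1 by rewrite /walsh big_set0.
pose D T := (T \subset Q) && (T != finset.set0).
pose g E := \sum_(T | D T) cover_prob T * walsh q T E.
(* The empty [T] reproduces the null law and cancels; by [walsh_marginal] so do the sets not inside
   [Q]. *)
have diffE t : transcript_law mixture t - transcript_law (Q := Q) (null_law q (n
  := n)) t =
    \sum_(E | transcript Q E == t) null_law q E * g E.
  rewrite /transcript_law -sumrB /=.
  rewrite (eq_bigr (fun E => \sum_(T | T != finset.set0) cover_prob T * (null_law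
    q E * walsh q T E))); last first.
    move=> E _; rewrite mixtureE (bigD1 finset.set0) //= cov0 walsh0 mulrDr !mulr1.
    by rewrite addrC addKr mulr_sumr; apply: eq_bigr => T _; rewrite mulrCA.
  rewrite exchange_big /= (bigID (fun T : {set upair n} => T \subset Q)) /=.
  rewrite [X in _ + X]big1 ?addr0 => [|T /andP[_ TQ]]; last first.
    by rewrite -mulr_sumr walsh_marginal ?mulr0.
  rewrite /g; under [RHS]eq_bigr do rewrite mulr_sumr.
  rewrite [RHS]exchange_big; apply: eq_big => [T|T _]; first by rewrite /D andbC.
  by apply: eq_bigr => E _; rewrite mulrCA.
have l1_le : \sum_t `|transcript_law mixture t - transcript_law (Q := Q)
  (null_law q (n := n)) t| <=
    \sum_(E : {set upair n}) null_law q E * `|g E|.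
  rewrite [leRHS](partition_big (transcript Q) predT) //=.
  apply: ler_sum => t _; rewrite diffE; apply: (le_trans (ler_norm_sum _ _ _)).
  by apply: ler_sum => E _; rewrite normrM ger0_norm ?null_law_ge0.
rewrite /dTV exprMn (_ : 2^-1 ^+ 2 = 4^-1 :> R); last by field.
apply: ler_wpM2l; first by rewrite invr_ge0.
apply: (@le_trans _ _ ((\sum_(E : {set upair n}) null_law q E * `|g E|) ^+ 2)).
  by apply: lerXn2r l1_le; rewrite nnegrE sumr_ge0 // => E _;
    rewrite mulr_ge0 ?null_law_ge0.
apply: (le_trans (sqr_mean_le _ _ _)); [exact: null_law_ge0|exact: sum_null_law|].
rewrite [in leRHS](bigD1 finset.set0) ?finset.sub0set //= cov0 cards0 expr0
  expr1n mulr1 addrAC subrr add0r.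
rewrite le_eqVlt; apply/orP; left; apply/eqP.
(* Parseval: the square is expanded into a double sum whose off-diagonal terms vanish by
   orthogonality. *)
transitivity (\sum_(E : {set upair n}) \sum_(T | D T) \sum_(T' | D T') cover_prob
  T * cover_prob T' * (null_law q E * (walsh q T E * walsh q T' E))).
  apply: eq_bigr => E _; rewrite real_normK ?num_real // expr2 /g mulr_suml mulr_sumr.
  apply: eq_bigr => T _; rewrite !mulr_sumr; apply: eq_bigr => T' _.
  by ring.
rewrite exchange_big /=; apply: eq_bigr => T DT.
rewrite exchange_big /= (bigD1 T) //= -mulr_sumr walsh_orthogonal // eqxx mul1r.
rewrite big1 ?addr0; first by rewrite mulrC expr2.
by move=> T' /andP[_ neqT]; rewrite -mulr_sumr walsh_orthogonal // eq_sym (negPf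
  neqT) mul0r mulr0.
Qed.

End Mixture.

(** * A uniform copy as the image of a uniform embedding *)

Section Copies.
Variables (n : nat) (Gamma : sgraph).
Implicit Types (f : {ffun Gamma -> 'I_n}) (H : {set 'I_n} * {set upair n}).

Definition edge_image f : {set upair n} :=
  [set e | [exists u, exists v, adj u v && (val e == [set f u; f v])]].

Definition copy_image f := (f @: [set: Gamma], edge_image f).

Lemma adj_edge_image f u v : injective f ->
  adj u v = ([set f u; f v] \in val @: edge_image f).
Proof.
move=> f_inj; apply/idP/imsetP => [uv|[e]].
  have card2 : #|[set f u; f v]| == 2%N.
    rewrite cards2 (inj_eq f_inj); have [eq_uv|//] := eqVneq u v.
    by rewrite eq_uv adj_irr in uv.
  exists (Sub [set f u; f v] card2) => //.
  by rewrite inE; apply/existsP; exists u; apply/existsP; exists v; rewrite uv /=.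
rewrite inE => /existsP[u' /existsP[v' /andP[uv' /eqP ->]]] /setP eqS.
(* Testing the set equality at all four ends leaves, by injectivity, the same edge in one of its two
   orientations. *)
have := eqS (f u); have := eqS (f v); have := eqS (f u'); have := eqS (f v').
rewrite !inE !(inj_eq f_inj) !eqxx /= ?orbT.
have neq : u' != v' by apply: contraTneq uv' => ->; rewrite adj_irr.
move=> /orP[]/eqP v'E /orP[]/eqP u'E _ _; subst; rewrite ?eqxx // in neq uv' *.
by rewrite adj_sym.
Qed.

Lemma is_copyP H :
  reflect (exists2 f : {ffun Gamma -> 'I_n}, injectiveb f & copy_image f = H)
    (is_copy Gamma H).
Proof.
apply: (iffP andP) => [[/forall_inP HE /existsP[f /and3P[f_inj /eqP fH /forallP
  adjH]]]|].
  exists f => //; case: H HE fH adjH => W F /= HE fW adjH; congr pair => //.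
  apply/setP => e; rewrite inE; apply/existsP/idP => [[u /existsP[v /andP[uv /eqP
    ee]]]|eF].
    move: uv; have /eqP -> := forallP (adjH u) v.
    by rewrite -ee mem_imset //; exact: val_inj.
  have /cards2P[x [y [_ exy]]] := valP e.
  have := HE e eF; rewrite exy -fW finset.subUset !finset.sub1set.
  move=> /andP[/imsetP[u _ xu] /imsetP[v _ yv]].
  exists u; apply/existsP; exists v; have /eqP -> := forallP (adjH u) v.
  by rewrite -xu -yv -exy eqxx andbT mem_imset //; exact: val_inj.
move=> [f f_inj <-]; split.
  apply/forall_inP => e; rewrite inE => /existsP[u /existsP[v /andP[_ /eqP ->]]].
  by rewrite finset.subUset !finset.sub1set !imset_f.
apply/existsP; exists f; rewrite f_inj eqxx /=.
by apply/forallP => u; apply/forallP => v; rewrite -adj_edge_image //; apply/injectiveP.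
Qed.

(** Fix embeddings [f0] onto [H] and [f1] onto [H']. Any [f] onto [H] is [f0] composed with an
    automorphism [h f] of [Gamma], and replacing [f0] by [f1] injects one fiber into the other. By
    symmetry all fibers have the same size. *)
Lemma card_copy_image_fiber_le H H' : H \in copies n Gamma -> H' \in copies n Gamma ->
  (#|[set f : {ffun Gamma -> 'I_n} | injectiveb f & copy_image f == H]| <=
   #|[set f : {ffun Gamma -> 'I_n} | injectiveb f & copy_image f == H']|)%N.
Proof.
rewrite !inE => /is_copyP[f0 /injectiveP f0_inj <-] /is_copyP[f1 /injectiveP f1_inj <-].
(* [h f] is the inverse of [f0] after [f]; the default [u] never occurs once the images agree. *)
pose h f u := odflt u [pick w | f0 w == f u].
have hE f : f @: [set: Gamma] = f0 @: [set: Gamma] -> forall u, f0 (h f u) = f u.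
  move=> eq_im u; rewrite /h; case: pickP => [w /eqP //|no].
  have : f u \in f0 @: [set: Gamma] by rewrite -eq_im imset_f ?inE.
  by case/imsetP => w _ fu; have := no w; rewrite fu eqxx.
pose push f : {ffun Gamma -> 'I_n} := [ffun u => f1 (h f u)].
set S := (X in (#|pred_of_set X| <= _)%N); have push_inj : {in S &, injective push}.
  move=> f f'; rewrite !inE => /andP[_ /eqP[imf _]] /andP[_ /eqP[imf' _]] /ffunP eqh.
  apply/ffunP => u; rewrite -(hE f) // -(hE f') //; congr (f0 _).
  by apply: f1_inj; have := eqh u; rewrite !ffunE.
apply: (@leq_trans #|push @: S|); first by rewrite (card_in_imset push_inj).
apply: subset_leq_card; apply/fintype.subsetP => _ /imsetP[f + ->].
rewrite !inE => /andP[/injectiveP f_inj /eqP[imf edf]].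
have h_inj : injective (h f).
  by move=> u v eqh; apply: f_inj; rewrite -(hE f imf u) -(hE f imf v) eqh.
have h_adj u v : adj (h f u) (h f v) = adj u v.
  rewrite (adj_edge_image u v f_inj) (adj_edge_image (h f u) (h f v) f0_inj).
  by rewrite edf !hE.
have [h' hK h'K] := injF_bij h_inj.
apply/andP; split; first by apply/injectiveP => u v; rewrite !ffunE => /f1_inj/h_inj.
rewrite /copy_image; apply/eqP; congr pair.
  apply/setP => x; apply/imsetP/imsetP => [][u _ ->].
    by exists (h f u); rewrite ?ffunE.
  by exists (h' u); rewrite ?ffunE ?h'K.
apply/setP => e; rewrite !inE; apply/existsP/existsP => [][u /existsP[v /andP[uv ee]]].
  exists (h f u); apply/existsP; exists (h f v).
  by rewrite h_adj uv; rewrite !ffunE in ee.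
exists (h' u); apply/existsP; exists (h' v).
by rewrite -h_adj !h'K uv !ffunE !h'K.
Qed.

Lemma planted_law_embeddings (R : realType) (q : R) (E : {set upair n}) :
  planted_law q Gamma E = #|[set f : {ffun Gamma -> 'I_n} | injectiveb f]|%:R^-1 *
    \sum_(f : {ffun Gamma -> 'I_n} | injectiveb f) planted_law_at q (edge_image f) E.
Proof.
have inC f : injectiveb f -> copy_image f \in copies n Gamma.
  by move=> f_inj; rewrite inE; apply/is_copyP; exists f.
(* Without copies there are no embeddings either, and both sides are 0. *)
rewrite /planted_law; have [C0|[H0 H0C]] := set_0Vmem (copies n Gamma).
  rewrite C0 big_set0 big1 ?mulr0 // => f /inC.
  by rewrite C0 inE.
pose k := #|[set f : {ffun Gamma -> 'I_n} | injectiveb f & copy_image f == H0]|.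
have fiberE H : H \in copies n Gamma ->
    #|[set f : {ffun Gamma -> 'I_n} | injectiveb f & copy_image f == H]| = k.
  by move=> HC; apply/eqP; rewrite eqn_leq !card_copy_image_fiber_le.
have k_gt0 : (0 < k)%N.
  move: H0C; rewrite inE => /is_copyP[f f_inj fH].
  by apply/card_gt0P; exists f; rewrite inE f_inj fH eqxx.
have sumE (phi : {set upair n} -> R) :
    \sum_(f : {ffun Gamma -> 'I_n} | injectiveb f) phi (edge_image f) =
    (\sum_(H in copies n Gamma) phi H.2) *+ k.
  rewrite (partition_big copy_image [in copies n Gamma]) //= -sumrMnl.
  apply: eq_bigr => H HC; rewrite -(fiberE H HC) -sumr_const.
  by apply: eq_big => [f|f /andP[_ /eqP <-]]; rewrite ?inE.
have -> : #|[set f : {ffun Gamma -> 'I_n} | injectiveb f]| = (#|copies n Gamma| * k)%N.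
  rewrite -sum1dep_card (partition_big copy_image [in copies n Gamma]) //=.
  rewrite -sum_nat_const; apply: eq_bigr => H HC.
  by rewrite sum1dep_card fiberE.
rewrite (sumE (fun F => planted_law_at q F E)) natrM invfM.
by rewrite -[X in _ = _ * X]mulr_natl mulrA mulfVK // pnatr_eq0 -lt0n.
Qed.

End Copies.

(** * Convexity and range of the total variation distance *)

Section TotalVariation.
Variable R : realType.

(** The distance is convex in its first argument by the triangle inequality, and Jensen handles the
    square. *)
Lemma sqr_dTV_mean_le (I T : finType) (p : I -> R) (mu : I -> T -> R) (nu : T -> R) :
  (forall i, 0 <= p i) -> \sum_i p i = 1 ->
  dTV (fun t => \sum_i p i * mu i t) nu ^+ 2 <= \sum_i p i * dTV (mu i) nu ^+ 2.
Proof.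
move=> p_ge0 p_sum1; apply: le_trans (sqr_mean_le _ p_ge0 p_sum1).
apply: lerXn2r; rewrite ?nnegrE ?mulr_ge0 ?sumr_ge0 //.
  by move=> i _; rewrite !mulr_ge0 ?sumr_ge0.
under [leRHS]eq_bigr do rewrite /dTV mulrCA mulr_sumr.
rewrite -mulr_sumr; apply: ler_wpM2l; first by rewrite invr_ge0.
rewrite exchange_big /=; apply: ler_sum => t _.
have nuE : \sum_i p i * nu t = nu t by rewrite -mulr_suml p_sum1 mul1r.
rewrite -{1}nuE -sumrB (le_trans (ler_norm_sum _ _ _)) //.
by apply: ler_sum => i _; rewrite -mulrBr normrM (ger0_norm (p_ge0 i)).
Qed.

Lemma dTV_le1 (T : finType) (mu nu : T -> R) :
  (forall t, 0 <= mu t) -> (forall t, 0 <= nu t) ->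
  \sum_t mu t = 1 -> \sum_t nu t = 1 -> dTV mu nu <= 1.
Proof.
move=> mu_ge0 nu_ge0 mu1 nu1; rewrite /dTV ler_pdivrMl // mulr1.
have -> : 2 = \sum_t (mu t + nu t) by rewrite big_split mu1 nu1.
apply: ler_sum => t _; rewrite (le_trans (ler_normB _ _)) //.
by rewrite !ger0_norm.
Qed.

Lemma dTV_ge0 (T : finType) (mu nu : T -> R) : 0 <= dTV mu nu.
Proof. by rewrite mulr_ge0 ?invr_ge0 ?sumr_ge0. Qed.

Lemma sum_transcript_law n (Q : {set upair n}) (P : {set upair n} -> R) :
  \sum_t transcript_law (Q := Q) P t = \sum_E P E.
Proof. by rewrite [RHS](partition_big (transcript Q) predT). Qed.

Lemma planted_law_at_ge0 (q : R) n (F E : {set upair n}) : 0 < q -> q < 1 ->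
  0 <= planted_law_at q F E.
Proof.
move=> q_gt0 q_lt1; apply: prodr_ge0 => e _.
by case: ifP => _; [rewrite ler0n|case: ifP => _; rewrite ?subr_ge0 ltW].
Qed.

Lemma sum_planted_law_at (q : R) n (F : {set upair n}) : 
  \sum_E planted_law_at q F E = 1.
Proof.
transitivity (\prod_(e : upair n)
    ((if e \in F then 1 else q) + (if e \in F then 0 else 1 - q))).
  rewrite bigA_distr; apply: eq_big => // E _; apply: eq_bigr => e _.
  by case: (e \in F); case: (e \in E).
by apply: big1 => e _; case: ifP => _; ring.
Qed.

End TotalVariation.

(** * Embeddings of the star forest with prescribed centers *)

Section CenterMap.
Variables (r : nat) (d : 'I_r -> nat) (n : nat).
Notation V := (vertex (star_forest d)).
Implicit Types (f : {ffun V -> 'I_n}) (c : {ffun 'I_r -> 'I_n}) (T : {set upair n}).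

Definition star_center (j : 'I_r) : V := existT (fun j => vertex (star (d j))) j None.

Definition star_leaf (j : 'I_r) (i : 'I_(d j)) : V :=
  existT (fun j => vertex (star (d j))) j (Some i).

Definition center_map f : {ffun 'I_r -> 'I_n} := [ffun j => f (star_center j)].

Definition embeddings_at c : {set {ffun V -> 'I_n}} :=
  [set f : {ffun V -> 'I_n} | injectiveb f & center_map f == c].

Lemma center_inj : injective star_center.
Proof. by move=> j j' /(congr1 (@tag _ _)). Qed.

Lemma leaf_inj j : injective (@star_leaf j).
Proof. by move=> i i' /eqP; rewrite eq_Tagged => /eqP[]. Qed.

Lemma leaf_neq_center j (i : 'I_(d j)) j' : star_leaf i != star_center j'.
Proof.
apply/eqP => eqlc; have eqj : j = j' := congr1 (@tag _ _) eqlc.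
by case: j' / eqj eqlc => /eqP; rewrite eq_Tagged.
Qed.

Lemma card_centers : #|star_center @: [set: 'I_r]| = r.
Proof. by rewrite card_imset ?cardsT ?card_ord //; exact: center_inj. Qed.

Lemma center_map_inj f : injectiveb f -> injectiveb (center_map f).
Proof.
by move=> /injectiveP f_inj; apply/injectiveP => j j';
  rewrite !ffunE => /f_inj/center_inj.
Qed.

Lemma edge_imageP f e : e \in edge_image f ->
  exists j (i : 'I_(d j)), val e = [set f (star_center j); f (star_leaf i)].
Proof.
rewrite inE => /existsP[[j u] /existsP[[j' v] /andP[]]].
rewrite /= /djunion_adj /= => /andP[/eqP eqj]; case: j' / eqj v => v.
rewrite tagged_asE /= /star_adj; case: u v => [i|] [i'|] //= _ /eqP eqe.
  by exists j, i; rewrite eqe finset.setUC.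
by exists j, i'.
Qed.

Lemma card_embeddings_at c : injectiveb c ->
  #|embeddings_at c| = ((n - r) ^_ (#|V| - r))%N.
Proof.
move=> /injectiveP c_inj.
have g_inj : {in star_center @: [set: 'I_r] &, injective (c \o @tag _ _ : V -> 'I_n)}.
  by move=> _ _ /imsetP[j _ ->] /imsetP[j' _ ->] /= /c_inj ->.
have := card_inj_extend g_inj; rewrite card_centers card_ord => <-.
apply: eq_card => f; rewrite !inE; congr (_ && _).
apply/eqP/forall_inP => [<- _ /imsetP[j _ ->]|H]; first by rewrite /= ffunE.
by apply/ffunP => j; rewrite ffunE; apply/eqP/H/imset_f.
Qed.

Lemma card_center_maps j y : 
  #|[set c : {ffun 'I_r -> 'I_n} | injectiveb c & c j == y]| = (n.-1 ^_ r.-1)%N.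
Proof.
have g_inj : {in [set j] &, injective (fun _ : 'I_r => y)}.
  by move=> i i'; rewrite !inE => /eqP -> /eqP ->.
have := card_inj_extend g_inj; rewrite cards1 !card_ord !subn1 => <-.
apply: eq_card => c; rewrite !inE; congr (_ && _).
apply/eqP/forall_inP => [<- _ /set1P -> //|H].
by apply/eqP/H; rewrite inE.
Qed.

(* The edges of [T] determine the star containing each of them and the image of
   the leaf, so an embedding covering [T] only chooses a leaf in each star. *)
Lemma card_embeddings_at_cover c T f0 : T != finset.set0 ->
  f0 \in embeddings_at c -> T \subset edge_image f0 ->
  exists2 s : upair n -> 'I_r, (forall e, e \in T -> c (s e) \in val e) &
  (#|T| <= #|V| - r)%N /\
  (#|[set f in embeddings_at c | T \subset edge_image f]| <=
   (\prod_(e in T) d (s e)) * (n - r - #|T|) ^_ (#|V| - r - #|T|))%N.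
Proof.
case/set0Pn => e0 e0T; rewrite inE => /andP[/injectiveP f0_inj /eqP f0c] Tf0.
have cE f j : center_map f = c -> f (star_center j) = c j by move=> <-; rewrite ffunE.
have c_inj : injective c.
  by apply/injectiveP; rewrite -f0c; apply/center_map_inj/injectiveP.
have edgeE f e : center_map f = c -> T \subset edge_image f -> e \in T ->
    exists j (i : 'I_(d j)), val e = [set c j; f (star_leaf i)].
  move=> fc /fintype.subsetP Tf /Tf/edge_imageP[j [i]].
  by rewrite (cE _ _ fc); exists j, i.
have [j0 [i0 _]] := edgeE f0 e0 f0c Tf0 e0T.
(* [f0] serves as reference: [s e] is the star and [i e] the leaf that realize [e]; outside [T] the
   values [j0], [i0] are mere defaults. *)
have /fin_all_exists[s /fin_all_exists[i si]] : forall e, exists j (i : 'I_(d j)),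
    e \in T -> val e = [set c j; f0 (star_leaf i)].
  move=> e; have [eT|_] := boolP (e \in T); last by exists j0, i0.
  by have [j [i ei]] := edgeE f0 e f0c Tf0 eT; exists j, i.
pose w e := star_leaf (i e).
have neq_c f j j' (k : 'I_(d j)) : injective f -> center_map f = c -> f
  (star_leaf k) <> c j'.
  by move=> f_inj fc; rewrite -(cE f) // => /f_inj/eqP;
    rewrite (negPf (leaf_neq_center _ _)).
(* Since [c] is injective and no leaf lands on a center, any [f] covering [e] uses the same star
   [s e] and sends one of its leaves to the same vertex as [f0] does. *)
have coverE f e : injective f -> center_map f = c -> T \subset edge_image f ->
    e \in T -> exists k : 'I_(d (s e)), f (star_leaf k) = f0 (w e).
  move=> f_inj fc Tf eT; have [j [k ek]] := edgeE f e fc Tf eT.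
  have eqS := si e eT; rewrite ek in eqS.
  have /set2P[/c_inj eqj|/esym/neq_c []//] : c j \in [set c (s e);
    f0 (star_leaf (i e))].
    by rewrite -eqS !inE eqxx.
  have : f (star_leaf k) \in [set c (s e); f0 (star_leaf (i e))] by rewrite -eqS
    !inE eqxx orbT.
  case/set2P => [/neq_c []//|]; move=> fk; clear ek eqS; move: k fk;
    rewrite eqj => k fk.
  by exists k.
pose S e : {set V} := [set star_leaf k | k : 'I_(d (s e))].
have card_touched (phi : upair n -> V) : (forall e, e \in T -> phi e \in S e) ->
    {in T &, injective phi} ->
    #|star_center @: [set: 'I_r] :|: phi @: T| = (r + #|T|)%N.
  move=> phiS phi_inj; rewrite cardsU card_centers (card_in_imset phi_inj).
  rewrite (_ : _ :&: _ = finset.set0) ?cards0 ?subn0 //.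
  apply/setP => u; rewrite !inE; apply/negP => /andP[/imsetP[j _ ->] /imsetP[e eT]].
  have /imsetP[k _ ->] := phiS e eT => /esym/eqP.
  by rewrite (negPf (leaf_neq_center _ _)).
have w_inj : {in T &, injective w}.
  move=> e e' eT e'T eqw; apply: val_inj; rewrite (si e eT) (si e' e'T) -/(w e)
    -/(w e').
  by rewrite eqw (congr1 (@tag _ _) eqw : s e = s e').
exists s => [e eT|]; first by rewrite (si e eT) !inE eqxx.
split.
  have wS e : e \in T -> w e \in S e by move=> _; exact: imset_f.
  by rewrite leq_subRL -?(card_touched w wS w_inj) ?max_card // -{1}card_centers
    max_card.
(* [P] ranges over the choices of one leaf of [s e] for each [e] in [T]; [Y phi] holds the
   embeddings that realize the choice [phi]. *)
pose P := [in pfamily (w e0) T S].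
pose Y (phi : {ffun upair n -> V}) :=
  [set f in embeddings_at c | [forall e in T, f (phi e) == f0 (w e)]].
apply: leq_trans (card_le_sum_cover (P := P) (Y := Y) _) _.
  move=> f; rewrite !inE => /andP[/andP[/injectiveP f_inj /eqP fc] Tf].
  have /fin_all_exists[phi phiE] : forall e, exists u : V,
      if e \in T then u \in S e /\ f u = f0 (w e) else u = w e0.
    move=> e; have [eT|_] := boolP (e \in T); last by exists (w e0).
    by have [k fk] := coverE f e f_inj fc Tf eT; exists (star_leaf k); split;
      first exact: imset_f.
  exists (finfun phi : {ffun upair n -> V}).
    apply/pfamilyP; split=> [|e eT]; last by have := phiE e; rewrite eT ffunE => -[].
    apply/fintype.subsetP => e; apply: contraR => /negPf eT.
    by have := phiE e; rewrite eT /= ffunE => ->.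
  rewrite !inE fc eqxx andbT; apply/andP; split; first exact/injectiveP.
  by apply/forall_inP => e eT; have := phiE e; rewrite eT ffunE => -[_ ->].
have -> : (\prod_(e in T) d (s e) = #|P|)%N.
  rewrite card_pfamily foldrE big_image; apply: eq_bigr => e _.
  by rewrite card_imset ?card_ord //; exact: leaf_inj.
rewrite -sum_nat_const; apply: leq_sum => phi /pfamilyP[_ phiS].
(* A realizable choice is injective on [T], so it fixes [r + #|T|] values, and the injective
   extensions of [f1] bound its embeddings. *)
have [->|[f1]] := set_0Vmem (Y phi); first by rewrite cards0.
rewrite !inE => /andP[/andP[/injectiveP f1_inj /eqP f1c] /forall_inP f1phi].
have phi_inj : {in T &, injective phi}.
  move=> e e' eT e'T eqphi; apply: w_inj => //; apply: f0_inj.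
  by rewrite -(eqP (f1phi e eT)) eqphi (eqP (f1phi e' e'T)).
rewrite -!subnDA -(card_touched phi phiS phi_inj) -[n in (n - _)%N]card_ord.
rewrite -(card_inj_extend (g := f1)); last by move=> u v _ _; exact: f1_inj.
apply: subset_leq_card; apply/fintype.subsetP => f.
rewrite !inE => /andP[/andP[-> /eqP fc] /forall_inP fphi] /=.
apply/forall_inP => u /setUP[/imsetP[j _ ->]|/imsetP[e eT ->]].
  by rewrite (cE f) ?(cE f1).
by rewrite (eqP (fphi e eT)) (eqP (f1phi e eT)).
Qed.

End CenterMap.

(** * Bound on the distance for a star forest, first given the centers, then averaged *)

Section StarForest.
Variables (R : realType) (q : R) (q_gt0 : 0 < q) (q_lt1 : q < 1).
Variables (r : nat) (d : 'I_r -> nat) (n : nat).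
Hypothesis fits : (#|star_forest d| <= n)%N.
Notation V := (vertex (star_forest d)).
Implicit Types (c : {ffun 'I_r -> 'I_n}) (T Q E : {set upair n}).

Definition embedding_weight c (f : {ffun V -> 'I_n}) : R :=
  (f \in embeddings_at d c)%:R / #|embeddings_at d c|%:R.

(** Bounds the squared contribution of one covered pair. Summing over all stars centered at an end
    of [e] avoids the star [s e], which depends on [T]. *)
Definition edge_weight c (e : upair n) : R :=
  (expR 1 / (n - r)%:R) ^+ 2 * \sum_j (d j)%:R ^+ 2 * (c j \in val e)%:R.

Lemma edge_weight_ge0 c e : 0 <= edge_weight c e.
Proof. by rewrite mulr_ge0 ?sqr_ge0 ?sumr_ge0 // => j _; rewrite mulr_ge0 ?sqr_ge0. Qed.

Lemma leq_centers_card : (r <= #|V|)%N.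
Proof. by have := max_card (star_center d @: [set: 'I_r]); rewrite card_centers. Qed.

Lemma card_embeddings_at_gt0 c : injectiveb c -> (0 < #|embeddings_at d c|)%N.
Proof.
by move=> c_inj; rewrite card_embeddings_at // ffact_gt0 leq_sub2r.
Qed.

Lemma embedding_weight_ge0 c f : 0 <= embedding_weight c f.
Proof. by rewrite mulr_ge0 ?invr_ge0. Qed.

Lemma sum_embedding_weight c : injectiveb c -> \sum_f embedding_weight c f = 1.
Proof.
move=> c_inj; rewrite -mulr_suml -natr_sum -big_mkcond sum1_card mulfV //.
by rewrite pnatr_eq0 -lt0n card_embeddings_at_gt0.
Qed.

Lemma sqr_cover_prob_le c T : injectiveb c ->
  cover_prob (embedding_weight c) (@edge_image n (star_forest d)) T ^+ 2 <=
  \prod_(e in T) edge_weight c e.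
Proof.
move=> c_inj; have [->|T_neq0] := eqVneq T finset.set0.
  rewrite big_set0 /cover_prob (eq_bigl predT) => [|f]; last by rewrite finset.sub0set.
  by rewrite sum_embedding_weight // expr1n.
set X := [set f in embeddings_at d c | T \subset edge_image f].
have -> : cover_prob (embedding_weight c) (@edge_image n (star_forest d)) T =
    #|X|%:R / #|embeddings_at d c|%:R.
  rewrite /cover_prob /embedding_weight -mulr_suml -natr_sum; congr (_%:R / _).
  rewrite -sum1_card [LHS]big_mkcond [RHS]big_mkcond; apply: eq_bigr => f _;
    rewrite [in RHS]inE andbC.
  by case: ifP => // _; case: ifP.
have [->|[f0]] := set_0Vmem X.
  by rewrite cards0 mul0r expr0n prodr_ge0 // => e _; exact: edge_weight_ge0.
rewrite inE => /andP[f0c Tf0].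
have [s sP [lekl leX]] := card_embeddings_at_cover T_neq0 f0c Tf0.
rewrite -/X in leX; set m := (n - r)%N; set l := (#|V| - r)%N; set k := #|T|.
have lelm : (l <= m)%N by rewrite leq_sub2r.
have m_gt0 : 0 < m%:R :> R.
  rewrite ltr0n (leq_trans _ lelm) // (leq_trans _ lekl) //.
  by rewrite card_gt0.
have ff_gt0 : 0 < (m ^_ k)%:R :> R by rewrite ltr0n ffact_gt0 (leq_trans lekl).
have ratio_le : #|X|%:R / #|embeddings_at d c|%:R <=
    \prod_(e in T) (expR 1 / m%:R * (d (s e))%:R : R).
  rewrite big_split /= prodr_const -/k -natr_prod card_embeddings_at // -/m -/l.
  rewrite -[l](subnKC lekl) ffactD natrM -/k.
  rewrite ler_pdivrMr ?mulr_gt0 ?ltr0n ?ffact_gt0 ?leq_sub2r ?(leq_trans lekl lelm) //.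
  apply: (@le_trans _ _ ((\prod_(e in T) d (s e))%N%:R * ((m - k) ^_ (l - k))%:R)).
    by rewrite -natrM ler_nat.
  (* The common factor (m-k)^_(l-k) is dropped; what remains is 1 <= (e/m)^k m^_k. *)
  rewrite mulrA; apply: ler_wpM2r => //.
  rewrite mulrAC; apply: ler_peMl => //.
  rewrite expr_div_n mulrAC ler_pdivlMr ?exprn_gt0 // mul1r.
  by apply: exp_ffact_le; apply: leq_trans lelm.
apply: (@le_trans _ _ (\prod_(e in T) (expR 1 / m%:R * (d (s e))%:R) ^+ 2)).
  rewrite prodrXl; apply: lerXn2r ratio_le; rewrite nnegrE ?mulr_ge0 ?invr_ge0 //.
  by apply: prodr_ge0 => e _; rewrite !mulr_ge0 ?invr_ge0 ?expR_ge0.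
apply: ler_prod => e eT; rewrite sqr_ge0 exprMn /=; apply: ler_wpM2l;
  first exact: sqr_ge0.
rewrite (bigD1 (s e)) //= sP // mulr1 lerDl sumr_ge0 //.
Qed.

Lemma sqr_dTV_center_le c Q : injectiveb c ->
  dTV (transcript_law (Q := Q) (mixture q (embedding_weight c) (@edge_image n
    (star_forest d))))
      (transcript_law (Q := Q) (null_law q (n := n))) ^+ 2 <=
  2 * ((q^-1 - 1) * \sum_(e in Q) edge_weight c e).
Proof.
move=> c_inj; set D := dTV _ _; set t := _ * \sum_(e in Q) _.
have a_ge0 : 0 <= q^-1 - 1 by rewrite subr_ge0 invf_ge1 // ltW.
have D_le : D ^+ 2 <= 4^-1 * (expR t - 1).
  apply: le_trans (sqr_dTV_mixture_le _ _ _ _ _) _ => //;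
    first exact: sum_embedding_weight.
  apply: ler_wpM2l; first by rewrite invr_ge0.
  rewrite lerB // /t mulr_sumr.
  apply: le_trans (prod_le_expR _ _); last first.
    by move=> e; rewrite mulr_ge0 ?edge_weight_ge0.
  rewrite -sum_subset_prod; apply: ler_sum => T _.
  rewrite big_split /= prodr_const; apply: ler_wpM2l; first exact: exprn_ge0.
  exact: sqr_cover_prob_le.
(* For t <= 1/2, exp(t) <= 1/(1-t) <= 1 + 2t gives D^2 <= t/2. For t > 1/2, the trivial bound D <= 1
   < 2t suffices. *)
have [t_le|t_gt] := lerP t 2^-1.
  apply: (le_trans D_le).
  have t_ge0 : 0 <= t.
    by rewrite mulr_ge0 // sumr_ge0 // => e _; exact: edge_weight_ge0.
  have lt1 : 0 < 1 - t by rewrite subr_gt0 (le_lt_trans t_le) // invf_lt1 ?ltr1n.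
  have expt : expR t <= (1 - t)^-1.
    rewrite -[t]opprK expRN lef_pV2 ?posrE ?expR_gt0 ?opprK //.
    exact: expR_ge1Dx.
  have invt : (1 - t)^-1 <= 1 + 2 * t.
    rewrite -[leLHS]mul1r ler_pdivrMr //; nra.
  by lra.
have D_le1 : D <= 1.
  apply: dTV_le1 => [y|y||].
  - apply: sumr_ge0 => E _; apply: sumr_ge0 => f _.
    by rewrite mulr_ge0 ?embedding_weight_ge0 ?planted_law_at_ge0.
  - by apply: sumr_ge0 => E _; exact: null_law_ge0.
  - rewrite sum_transcript_law exchange_big /= -[RHS](sum_embedding_weight c_inj).
    by apply: eq_bigr => f _; rewrite -mulr_sumr sum_planted_law_at mulr1.
  - by rewrite sum_transcript_law sum_null_law.
have : D ^+ 2 <= 1 by rewrite expr_le1 // dTV_ge0.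
by move: t_gt => ? ?; lra.
Qed.

Definition center_weight c : R := (injectiveb c)%:R / (n ^_ r)%:R.

(** The embeddings number n^_r (n-r)^_(|V|-r), and the second factor is the same for every injective
    center map: the centers are uniform, and so is the embedding given them. *)
Lemma planted_law_centers E :
  planted_law q (star_forest d) E =
  \sum_c center_weight c * mixture q (embedding_weight c) (@edge_image n
    (star_forest d)) E.
Proof.
rewrite planted_law_embeddings card_inj_ffuns card_ord.
rewrite -[#|_|](subnKC leq_centers_card) ffactD natrM invfM.
rewrite (partition_big (@center_map r d n) (fun c : {ffun _} => injectiveb c)) /=;
  last first.
  exact: center_map_inj.
rewrite mulr_sumr big_mkcond; apply: eq_bigr => c _; rewrite /center_weight.
case: ifPn => [c_inj|_]; last by rewrite !mul0r.
rewrite mul1r -mulrA; congr (_ * _).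
rewrite /mixture big_mkcond mulr_sumr; apply: eq_bigr => f _.
rewrite /embedding_weight card_embeddings_at // inE.
by case: ifP; rewrite ?mulr0 ?mul0r ?mul1r.
Qed.

Lemma center_weight_ge0 c : 0 <= center_weight c.
Proof. by rewrite mulr_ge0 ?invr_ge0. Qed.

Lemma leq_centers_n : (r <= n)%N.
Proof. exact: leq_trans leq_centers_card fits. Qed.

Lemma sum_center_weight : \sum_c center_weight c = 1.
Proof.
rewrite -mulr_suml -natr_sum -big_mkcond sum1dep_card card_inj_ffuns !card_ord.
by rewrite mulfV // pnatr_eq0 -lt0n ffact_gt0 leq_centers_n.
Qed.

(** The center of star [j] is uniform on the [n] vertices, and [e] has two ends. *)
Lemma sum_center_weight_mem j (e : upair n) :
  \sum_c center_weight c * (c j \in val e)%:R = 2 / n%:R.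
Proof.
have r_gt0 : (0 < r)%N := leq_ltn_trans (leq0n j) (ltn_ord j).
have n_gt0 : (0 < n)%N := leq_trans r_gt0 leq_centers_n.
have -> : \sum_c center_weight c * (c j \in val e)%:R =
    \sum_(y in val e) (n.-1 ^_ r.-1)%:R / (n ^_ r)%:R.
  under [RHS]eq_bigr => y _ do rewrite -(card_center_maps j y) -sum1_card
    natr_sum mulr_suml big_mkcond.
  rewrite exchange_big /=; apply: eq_bigr => c _; rewrite /center_weight.
  rewrite (eq_bigr (fun y => if c j == y then (injectiveb c)%:R / (n ^_ r)%:R
    else 0)); last first.
    by move=> y _; rewrite inE; case: (injectiveb c); case: (c j == y); rewrite ?mul0r.
  rewrite -big_mkcondr /=; case: (boolP (c j \in val e)) => ce.
    rewrite mulr1 (big_pred1 (c j)) // => y.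
    by rewrite [RHS]eq_sym; case: eqP => [<-|]; rewrite ?ce ?andbT ?andbF.
  rewrite mulr0 big_pred0 // => y.
  by case: eqP => [<-|]; rewrite ?(negPf ce) ?andbF.
have ff_neq0 : (n.-1 ^_ r.-1)%:R != 0 :> R.
  by rewrite pnatr_eq0 -lt0n ffact_gt0 -!subn1 leq_sub2r ?leq_centers_n.
rewrite sumr_const (eqP (valP e)) -{2}(prednK r_gt0) ffactnS natrM.
by rewrite invfM mulrCA mulfV ?mulr1 // mulr_natl.
Qed.

(** Averages the bound given the centers. The constant 4 is the 2 of that bound times the 2 ends of
    a pair. *)
Lemma sqr_dTV_planted_le Q :
  dTV (transcript_law (Q := Q) (planted_law q (star_forest d)))
      (transcript_law (Q := Q) (null_law q (n := n))) ^+ 2 <=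
  4 * (q^-1 - 1) * expR 1 ^+ 2 *
  ((#|Q| * sum_sq_deg d)%:R / (n%:R * (n%:R - r%:R) ^+ 2)).
Proof.
set nu := transcript_law (null_law _ (n := _)).
pose mu c := transcript_law (Q := Q)
  (mixture q (embedding_weight c) (@edge_image n (star_forest d))).
have -> : transcript_law (Q := Q) (planted_law q (star_forest d)) =
    fun t => \sum_c center_weight c * mu c t.
  apply/funext => t; rewrite /transcript_law.
  under eq_bigr do rewrite planted_law_centers.
  by rewrite exchange_big /=; apply: eq_bigr => c _; rewrite mulr_sumr.
apply: le_trans (sqr_dTV_mean_le _ _ center_weight_ge0 sum_center_weight) _.
apply: (@le_trans _ _ (\sum_c center_weight c * (2 * ((q^-1 - 1) * \sum_(e in Q)
  edge_weight c e)))).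
  apply: ler_sum => c _; have [c_inj|/negPf c_inj] := boolP (injectiveb c).
    by apply: ler_wpM2l; [exact: center_weight_ge0|exact: sqr_dTV_center_le].
  by rewrite /center_weight c_inj !mul0r.
rewrite le_eqVlt; apply/orP; left; apply/eqP.
have -> : \sum_c center_weight c * (2 * ((q^-1 - 1) * \sum_(e in Q) edge_weight c e)) =
    2 * (q^-1 - 1) * (expR 1 / (n - r)%:R) ^+ 2 *
    \sum_(e in Q) \sum_j (d j)%:R ^+ 2 * \sum_c center_weight c * (c j \in val e)%:R.
  rewrite mulr_sumr.
  under eq_bigr do rewrite mulrA mulrCA [_ * (_ * _)]mulrA !mulr_sumr.
  rewrite exchange_big; apply: eq_bigr => e _ /=.
  rewrite mulr_sumr; under [RHS]eq_bigr do rewrite mulr_sumr mulr_sumr.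
  rewrite [RHS]exchange_big; apply: eq_bigr => c _ /=.
  rewrite /edge_weight !mulr_sumr; apply: eq_bigr => j _.
  by ring.
under eq_bigr do under eq_bigr do rewrite sum_center_weight_mem.
rewrite sumr_const -mulr_suml -natrB ?leq_centers_n // natrM /sum_sq_deg natr_sum.
under [in RHS]eq_bigr do rewrite natrX.
rewrite -[X in _ * X = _]mulr_natr invfM -exprVn.
by set S := \sum_j _; ring.
Qed.

End StarForest.

(** * From the distance bound to the risk and its limit *)

Lemma optimal_risk_bounds (R : realType) (q : R) (q_gt0 : 0 < q) (q_lt1 : q < 1)
    (n r : nat) (d : 'I_r -> nat) (budget : nat) :
  (#|star_forest d| <= n)%N ->
  1 - Num.sqrt (4 * (q^-1 - 1) * expR 1 ^+ 2 *
    ((budget * sum_sq_deg d)%:R / (n%:R * (n%:R - r%:R) ^+ 2)))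
  <= optimal_risk q n (star_forest d) budget <= 1.
Proof.
move=> fits; rewrite /optimal_risk; set X := image _ _; set B := Num.sqrt _.
have ubX : ubound X B.
  move=> _ [Q /= leQ <-].
  rewrite -[leLHS]ger0_norm ?dTV_ge0 // -sqrtr_sqr ler_wsqrtr //.
  apply: (le_trans (sqr_dTV_planted_le q_gt0 q_lt1 fits Q)).
  apply: ler_wpM2l.
    by rewrite !mulr_ge0 ?subr_ge0 ?sqr_ge0 // invf_ge1 // ltW.
  apply: ler_wpM2r; first by rewrite invr_ge0 mulr_ge0 ?sqr_ge0.
  by rewrite ler_nat leq_mul2r leQ orbT.
(* The empty query set fits every budget, so the supremum is over a nonempty set and is
   nonnegative. *)
have X0 : X (dTV (transcript_law (Q := finset.set0) (planted_law q (star_forest d)))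
    (transcript_law (Q := finset.set0) (null_law q (n := n)))).
  by exists finset.set0 => //=; rewrite cards0.
apply/andP; split; first by rewrite lerD2l lerN2 ge_sup //; eexists; exact: X0.
rewrite gerBl; apply: le_trans (dTV_ge0 _ _) (ub_le_sup _ X0).
by exists B.
Qed.

Lemma leq_double_stars (r : nat) (d : 'I_r -> nat) :
  (forall j, (1 <= d j)%N) -> (r.*2 <= #|star_forest d|)%N.
Proof.
move=> d_ge1; rewrite card_tagged sumnE big_map big_enum /=.
rewrite -muln2 -[r in (r * _)%N]card_ord -sum_nat_const; apply: leq_sum => j _.
by rewrite card_option card_ord ltnS.
Qed.

Local Open Scope classical_set_scope.

Theorem corollary11 (R : realType) (q : R) (q_gt0 : 0 < q) (q_lt1 : q < 1)
    (r : nat -> nat) (d : forall n : nat, 'I_(r n) -> nat)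
    (budget : nat -> nat)
    (r_ge1 : \forall n \near \oo, (1 <= r n)%N)
    (d_ge1 : \forall n \near \oo, forall j : 'I_(r n), (1 <= d n j)%N)
    (fits : \forall n \near \oo, (#|star_forest (d n)| <= n)%N) :
  ((budget n * sum_sq_deg (d n))%:R
      / (n%:R * (n%:R - (r n)%:R) ^+ 2) @[n --> \oo] --> (0 : R) ->
    weak_detection_impossible q (fun n => star_forest (d n)) budget)
  /\
  ((fun n => (r n)%:R : R^o) =o_\oo (fun n => n%:R : R^o) ->
   (fun n => (budget n)%:R : R^o) =o_\oo
     (fun n => n%:R ^+ 3 / (sum_sq_deg (d n))%:R : R^o) ->
    weak_detection_impossible q (fun n => star_forest (d n)) budget).
Proof.
set x := (X in X @ _ --> _).
have main : x n @[n --> \oo] --> (0 : R) ->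
    weak_detection_impossible q (fun n => star_forest (d n)) budget.
  move=> x_to0; rewrite /weak_detection_impossible.
  pose K : R := 4 * (q^-1 - 1) * expR 1 ^+ 2.
  (* The risk lies between 1 - sqrt(K x_n) and 1, and the square root is continuous at 0. *)
  apply: (@squeeze_cvgr _ _ _ _ (fun n => 1 - Num.sqrt (K * x n)) (fun=> 1)).
  - by near=> n; apply: optimal_risk_bounds => //; near: n.
  - rewrite -[X in _ --> X]subr0; apply: cvgB; first exact: cvg_cst.
    rewrite -[X in _ --> X]sqrtr0; apply: (continuous_cvg _ (@sqrt_continuous R 0)).
    by rewrite -(mulr0 K); apply: cvgMr.
  - exact: cvg_cst.
split => // _ /eqoP budget_o; apply: main.
apply/cvgr0Pnorm_le => eps eps_gt0.
(* The factor 4 pays for replacing (n - r)^2 by n^2/4. *)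
have eps4_gt0 : 0 < eps / 4 by rewrite divr_gt0.
have := budget_o _ eps4_gt0; rewrite near_simpl => budget_le.
near=> n.
have fits_n : (#|star_forest (d n)| <= n)%N by near: n.
have d_ge1_n : forall j, (1 <= d n j)%N by near: n.
have b_le : `|(budget n)%:R : R| <= eps / 4 * `|n%:R ^+ 3 / (sum_sq_deg (d
  n))%:R| by near: n.
have r_gt0 : (0 < r n)%N by near: n.
have r2 : 2 * (r n)%:R <= n%:R :> R.
  rewrite -natrM ler_nat mul2n; exact: leq_trans (leq_double_stars d_ge1_n) fits_n.
have r_pos : 0 < (r n)%:R :> R by rewrite ltr0n.
rewrite /x; move: (n%:R : R) ((r n)%:R : R) r2 r_pos b_le => N r' r2 r_pos.
have N_gt0 : 0 < N by lra.
have sq_le : N ^+ 2 / 4 <= (N - r') ^+ 2.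
  (* This product is the factored form of (N - r')^2 - N^2/4; both factors are nonnegative since 2
     r' <= N. *)
  have : 0 <= (N / 2 - r') * (3 / 2 * N - r') by apply: mulr_ge0; lra.
  by lra.
have den_gt0 : 0 < N * (N - r') ^+ 2.
  by rewrite mulr_gt0 // (lt_le_trans _ sq_le) // divr_gt0 ?exprn_gt0.
rewrite natrM; have : 0 <= (sum_sq_deg (d n))%:R :> R by [].
have : 0 <= (budget n)%:R :> R by [].
move: ((sum_sq_deg _)%:R : R) ((budget n)%:R : R) => S b b_ge0.
rewrite le_eqVlt => /predU1P[<- _|S_gt0].
  by rewrite mulr0 mul0r normr0 ltW.
rewrite !ger0_norm ?mulr_ge0 ?invr_ge0 ?exprn_ge0 ?sqr_ge0 ?(ltW N_gt0) ?(ltW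
  S_gt0) ?(ltW den_gt0) //.
rewrite mulrA ler_pdivlMr // => bS.
rewrite ler_pdivrMr // (le_trans bS) // -mulrA ler_wpM2l ?(ltW eps_gt0) //.
by rewrite exprS mulrCA ler_wpM2l ?(ltW N_gt0) // mulrC.
Unshelve. all: by end_near.
Qed.
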